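(* Let $\mathcal{I}_*(X_{-1,-1})=[l_*(X_{-1,-1}),u_*(X_{-1,-1})]$ be a random interval. Suppose that for some sequences $\tau_0\gtrsim 1$, we have $$\sup_{M\in\mathcal{M}^{(1)}}\mathbb{E}_M|\mathcal{I}_*(X_{-1,-1})|=o(1).$$ If $\tau_2\gtrsim1$, then $$\limsup_{n,T\to\infty}\ \inf_{M\in\mathcal{M}^{(2)}}\mathbb{P}_M\left(M_{1,1}\in\mathcal{I}_*(X_{-1,-1})\right)\le\frac12 .$$
   Context: Model: $X=M+u$ where $M\in\mathbb{R}^{n\times T}$ is a low-rank matrix and the entries $u_{i,t}$ of $u\in\mathbb{R}^{n\times T}$ are i.i.d. $N(0,1)$. The observed data is $X_{-1,-1}$, i.e. all entries of $X$ except the $(1,1)$ entry (formally, $A_{-1,-1}$ is $A$ with its $(1,1)$ entry replaced by zero). $\mathbb{P}_M,\mathbb{E}_M$ denote probability and expectation when the mean matrix is $M$. For a matrix $A$, $\|A\|_\infty=\max_{i,j}|A_{i,j}|$ and $\sigma_1(A)\ge\sigma_2(A)\ge\cdots$ are its singular values. Let $\kappa>0$ be a constant and let $\tau_0,\tau_1,\tau_2$ (which may depend on $(n,T)$) satisfy $\tau_1\ge\tau_2>0$ and $\tau_1\le\tau_0$. Define $\mathcal{M}=\{A\in\mathbb{R}^{n\times T}:\|A\|_\infty\le\kappa,\ \mathrm{rank}\,A\le2\}$, $\mathcal{M}^{(1)}=\{A\in\mathcal{M}:\sigma_1(A)\ge\tau_0,\ \sigma_2(A)=0\}$, $\mathcal{M}^{(2)}=\{A\in\mathcal{M}:\sigma_1(A)\ge\tau_1,\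 \sigma_2(A)\le\tau_2\}$. For an interval $\mathcal{I}_*=[l_*,u_*]$, $|\mathcal{I}_*|=u_*-l_*$. For a positive sequence, $\tau\gtrsim1$ means that $\tau$ is bounded below by a positive constant.
   Formalization: Added assumptions: for all large n,T the class M^(1) is nonempty, and τ1² + δ ≤ κ²nT for some fixed δ > 0; without the latter the claim fails, e.g. for τ0 = τ1 = κ√(nT), τ2 = 1, where M_{1,1} can be recovered exactly with probability tending to 1. *)

(* Defs.v *)
From HB Require Import structures.
From mathcomp Require Import all_boot all_order all_algebra.
From mathcomp Require Import all_classical all_reals all_analysis.
Set Implicit Arguments.
Unset Strict Implicit.
Unset Printing Implicit Defensive.
Import Order.TTheory GRing.Theory Num.Theory.
Import numFieldNormedType.Exports.
Local Open Scope classical_set_scope.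
Local Open Scope ring_scope.

(* [s] lists, in nonincreasing order, the nonnegative square roots of the
   eigenvalues of A^T A, counted with (algebraic) multiplicity. *)
Definition is_singular_values (R : realType) (m n : nat) (A : 'M[R]_(m, n))
    (s : seq R) : Prop :=
  [/\ sorted (fun x y => y <= x) s, all (fun x => 0 <= x) s &
      char_poly (A^T *m A) = \prod_(x <- s) ('X - (x ^+ 2)%:P)].

(* Such a list always exists (A^T A is symmetric positive semidefinite) and is
   unique, so the default value [::] is never used.  The list has length n;
   when n > m this only appends zeros to the usual min(m, n) values. *)
Definition singular_values (R : realType) (m n : nat) (A : 'M[R]_(m, n)) :
    seq R :=
  xget [::] [set s | is_singular_values A s].

(* One-based, as in sigma_1 >= sigma_2 >= ...; 0 beyond the last one. *)
Definition sigma (R : realType) (k : nat) (m n : nat) (A : 'M[R]_(m, n)) : R :=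
  (singular_values A)`_k.-1.

(* [mx_norm] is the largest absolute value of an entry. *)
Definition Mclass (R : realType) (m n : nat) (kappa : R) : set 'M[R]_(m, n) :=
  [set A : 'M[R]_(m, n) | mx_norm A <= kappa /\ (\rank A <= 2)%N].

Definition Mclass1 (R : realType) (m n : nat) (kappa tau0 : R) :
    set 'M[R]_(m, n) :=
  [set A : 'M[R]_(m, n) | [/\ Mclass kappa A, tau0 <= sigma 1 A & sigma 2 A = 0]].

Definition Mclass2 (R : realType) (m n : nat) (kappa tau1 tau2 : R) :
    set 'M[R]_(m, n) :=
  [set A : 'M[R]_(m, n) | [/\ Mclass kappa A, tau1 <= sigma 1 A & sigma 2 A <= tau2]].

Definition drop11 (R : realType) (m n : nat) (A : 'M[R]_(m.+1, n.+1)) :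
    'M[R]_(m.+1, n.+1) :=
  \matrix_(i, j) if (i == ord0) && (j == ord0) then 0 else A i j.

(* The Borel sigma-algebra on matrices, generated by the coordinate maps. *)
Definition mx_cylinders (R : realType) (m n : nat) : set (set 'M[R]_(m, n)) :=
  [set C | exists (i : 'I_m) (j : 'I_n) (B : set R),
     measurable B /\ C = [set A : 'M[R]_(m, n) | B (A i j)]].

Definition mx_measurable (R : realType) (m n : nat) (f : 'M[R]_(m, n) -> R) :
    Prop :=
  measurable_fun [set: g_sigma_algebraType (@mx_cylinders R m n)] f.

Record interval_procedure (R : realType) (m n : nat) := IntervalProcedure {
  lower : 'M[R]_(m, n) -> R ;
  upper : 'M[R]_(m, n) -> R ;
  lower_measurable : mx_measurable lower ;
  upper_measurable : mx_measurable upper ;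
  lower_le_upper : forall A, lower A <= upper A }.

(* [0 1] are the mean and the standard deviation.  The product rule over the
   whole finite index set contains the one over each subfamily (take B = setT
   on the other indices). *)
Definition iid_std_normal (R : realType) (d : measure_display)
    (Omega : measurableType d) (P : probability Omega R) (m n : nat)
    (u : 'I_m -> 'I_n -> {RV P >-> R}) : Prop :=
  (forall i j (B : set R), measurable B ->
     distribution P (u i j) B = normal_prob 0 1 B) /\
  (forall B : 'I_m -> 'I_n -> set R, (forall i j, measurable (B i j)) ->
     P [set w | forall i j, B i j (u i j w)] =
     (\prod_(i < m) \prod_(j < n) P (u i j @^-1` B i j))%E).

Definition observed (R : realType) (d : measure_display)
    (Omega : measurableType d) (P : probability Omega R) (m n : nat)
    (u : 'I_m.+1 -> 'I_n.+1 -> {RV P >-> R}) (M : 'M[R]_(m.+1, n.+1))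
    (w : Omega) : 'M[R]_(m.+1, n.+1) :=
  drop11 (M + \matrix_(i, j) u i j w).

Definition coverage (R : realType) (d : measure_display)
    (Omega : measurableType d) (P : probability Omega R) (m n : nat)
    (u : 'I_m.+1 -> 'I_n.+1 -> {RV P >-> R})
    (I : interval_procedure R m.+1 n.+1) (M : 'M[R]_(m.+1, n.+1)) : \bar R :=
  P [set w | lower I (observed u M w) <= M ord0 ord0
                                      <= upper I (observed u M w)].

Definition expected_length (R : realType) (d : measure_display)
    (Omega : measurableType d) (P : probability Omega R) (m n : nat)
    (u : 'I_m.+1 -> 'I_n.+1 -> {RV P >-> R})
    (I : interval_procedure R m.+1 n.+1) (M : 'M[R]_(m.+1, n.+1)) : \bar R :=
  expectation P (fun w => upper I (observed u M w) - lower I (observed u M w)).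

(* tau >~ 1 for a doubly indexed sequence; (n.+1, T.+1) runs over all pairs of
   positive dimensions. *)
Definition gtrsim1 (R : realType) (tau : nat -> nat -> R) : Prop :=
  exists2 c : R, 0 < c & forall n T, c <= tau n.+1 T.+1.

(* Main.v *)
Require Import Defs.
From HB Require Import structures.
From mathcomp Require Import all_boot all_order all_algebra.
From mathcomp Require Import all_classical all_reals all_analysis.
From mathcomp Require Import measurable_realfun ring lra.

(** The interval is computed without the (1,1) entry, so two means that differ
only there give the same interval.  If such means [M] and [M'] both lie in the
second class and differ by a fixed [c > 0], the interval has to cover two
points at distance [c].  On each outcome the number of covered points is at
most [1 + length / c], hence
  coverage M + coverage M' <= 1 + expected_length M / c
([coverage_two_points]).  If moreover [M] lies in the first class, the right
side tends to 1, and the smaller of the two coverages is at most 1/2 in the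
limit.

The pair is explicit: [M] has all its entries equal to [kappa], and [M'] is [M]
with the (1,1) entry lowered to [kappa - c].  The matrix [M] has the largest
[sigma_1] compatible with the entrywise bound, because [sigma_1 ^ 2] is at most
the squared Frobenius norm ([sqr_sigma1_le]); so it belongs to the first class
as soon as that class is nonempty ([Mclass1_flat]).  The rank of [M'] is at most
two, and its squared singular values are the roots of an explicit quadratic
([char_poly_dented]), whose value at [c ^ 2] is nonpositive.  Therefore [c ^ 2]
separates the roots: [sigma_2 <= c], which is below [tau_2] for small [c], and
[sigma_1 ^ 2 >= kappa ^ 2 n T - 2 kappa c], which is above [tau_1 ^ 2] because
[tau_1] keeps away from the maximal value ([sigma_dented]). *)

Set Implicit Arguments.
Unset Strict Implicit.
Unset Printing Implicit Defensive.
Import Order.TTheory GRing.Theory Num.Theory.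
Import numFieldNormedType.Exports.
Local Open Scope classical_set_scope.
Local Open Scope ring_scope.

(** * Characteristic polynomials of low-rank products *)

(** The Weinstein-Aronszajn identity.  Multiplying [[X, B; C, 1]] on the right by
[[1, -B; 0, X]] or by [[1, 0; -C, 1]] makes it block triangular, so its
determinant has two expressions. *)
Lemma char_poly_mulC (F : comNzRingType) (p q : nat) (B : 'M[F]_(p, q))
    (C : 'M[F]_(q, p)) :
  'X^q * char_poly (B *m C) = 'X^p * char_poly (C *m B).
Proof.
rewrite /char_poly /char_poly_mx !map_mxM /=.
move: (map_mx polyC B) (map_mx polyC C) => b c.
pose L := block_mx 'X%:M b c 1%:M; pose U := block_mx 1%:M (- b) 0 'X%:M.
pose V := block_mx 1%:M 0 (- c) 1%:M.
have LU : L *m U = block_mx 'X%:M 0 c ('X%:M - c *m b).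
  rewrite mulmx_block !mulmx1 !mul1mx !mulmx0 !addr0 !mulmxN.
  by rewrite mul_scalar_mx mul_mx_scalar addNr addrC.
have LV : L *m V = block_mx ('X%:M - b *m c) b 0 1%:M.
  by rewrite mulmx_block !mulmx1 !mul1mx !mulmx0 !add0r mulmxN subrr.
have := congr1 determinant LU; have := congr1 determinant LV.
rewrite !det_mulmx !det_lblock !det_ublock !det1 !det_scalar !mul1r !mulr1.
by move=> -> <-; rewrite mulrC.
Qed.

Lemma char_poly2 (F : comNzRingType) (A : 'M[F]_2) (x y : F) :
  \tr A = x + y -> \det A = x * y ->
  char_poly A = ('X - x%:P) * ('X - y%:P).
Proof.
move=> trA detA.
have sz : size (char_poly A) = 3 by rewrite size_char_poly.
have e0 : (char_poly A)`_0 = x * y.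
  by rewrite char_poly_det detA sqrrN expr1n mul1r.
have e1 : (char_poly A)`_1 = - (x + y) by rewrite char_poly_trace// trA.
have e2 : (char_poly A)`_2 = 1.
  by have /monicP := char_poly_monic A; rewrite /lead_coef sz.
have -> : ('X - x%:P) * ('X - y%:P) =
    'X^2 - (x + y)%:P * 'X + (x * y)%:P :> {poly F}.
  by rewrite polyCD polyCM; ring.
have e3 i : (char_poly A)`_i.+3 = 0 by rewrite nth_default// sz.
apply/polyP => -[|[|[|i]]]; rewrite ?e0 ?e1 ?e2 ?e3 !coefE/=.
- by rewrite !mulr0 subr0 add0r.
- by rewrite mulr1 add0r addr0.
- by rewrite mulr0 subr0 addr0.
- by rewrite mulr0 subr0 addr0.
Qed.

(** * Singular values *)

(** Two squares and zeros split the characteristic polynomial of the Gram matrix,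
so a singular value list exists; unique factorization over a field, followed by
sorting, makes it the only one. *)
Lemma sigma_char_poly (R : realType) (m k : nat) (A : 'M[R]_(m, k.+2)) (x y : R) :
  0 <= y -> y <= x ->
  char_poly (A^T *m A) = 'X^k * (('X - (x ^+ 2)%:P) * ('X - (y ^+ 2)%:P)) ->
  sigma 1 A = x /\ sigma 2 A = y.
Proof.
move=> y0 yx cpA.
pose s := x :: y :: nseq k 0.
have x0 : 0 <= x := le_trans y0 yx.
have s_sorted : sorted (fun a b => b <= a) s.
  rewrite /= yx/=; case: k {A cpA s} => //= k; rewrite y0/=.
  by elim: k => //= k ->; rewrite lexx.
have s_ge0 : all (fun a => 0 <= a) s by rewrite /= x0 y0 all_nseq lexx orbT.
have sA : is_singular_values A s.
  split=> //; rewrite cpA !big_cons big_nseq expr0n/= subr0 iter_mulr_1.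
  by rewrite mulrC mulrA.
have : is_singular_values A (singular_values A).
  exact: (xgetPex [::] (ex_intro _ s sA)).
case=> t_sorted t_ge0; rewrite /sigma.
move: (singular_values A) t_sorted t_ge0 => t t_sorted t_ge0.
case: sA => _ _ ->.
rewrite -(big_map (fun a => a ^+ 2) predT (fun a => 'X - a%:P)).
rewrite -[RHS](big_map (fun a => a ^+ 2) predT (fun a => 'X - a%:P)).
move=> /prod_XsubC_eq perm_st.
have sqs (u : seq R) : all (fun a => 0 <= a) u ->
    map Num.sqrt (map (fun a => a ^+ 2) u) = u.
  move=> /allP u_ge0; rewrite -map_comp -[RHS]map_id; apply/eq_in_map => a au /=.
  by rewrite sqrtr_sqr ger0_norm// u_ge0.
have /(perm_map Num.sqrt) := perm_st; rewrite !sqs// => {}perm_st.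
have <- : s = t; last by [].
apply: (sorted_eq _ _ s_sorted t_sorted perm_st).
- by move=> b a c /= ba cb; exact: le_trans cb ba.
- by move=> a b /= /andP[ba ab]; apply/eqP; rewrite eq_le ab.
Qed.

(** The trace of the Gram matrix is the sum of the squared singular values, read
off the subleading coefficient of the characteristic polynomial.  If no
singular value list existed, [sigma 1 A] would be the default value zero, and
the bound would hold as well. *)
Lemma sqr_sigma1_le_tr (R : realType) (m n : nat) (A : 'M[R]_(m, n)) :
  sigma 1 A ^+ 2 <= \tr (A^T *m A).
Proof.
rewrite /sigma; have [[s sA]|nosv] := pselect (exists s, is_singular_values A s).
  have : is_singular_values A (singular_values A).
    exact: (xgetPex [::] (ex_intro _ s sA)).
  move: (singular_values A) => t [_ _] cpA.
  (* the degree of the characteristic polynomial *)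
  have szt : size t = n.
    apply: succn_inj; rewrite -(size_char_poly (A^T *m A)) cpA.
    rewrite -(big_map (fun a => a ^+ 2) predT (fun a => 'X - a%:P)).
    by rewrite size_prod_XsubC size_map.
  case: n A cpA szt {s sA} => [|n] A cpA szt.
    by rewrite (size0nil szt) nth_nil expr0n /mxtrace big_ord0.
  have trA : \tr (A^T *m A) = \sum_(a <- t) a ^+ 2.
    apply: oppr_inj; rewrite -char_poly_trace// cpA.
    rewrite -(big_map (fun a => a ^+ 2) predT (fun a => 'X - a%:P)).
    have := @coefPn_prod_XsubC R (map (fun a => a ^+ 2) t).
    by rewrite size_map szt !big_map => ->.
  rewrite trA; case: t szt {cpA trA} => //= a t _.
  by rewrite big_cons lerDl sumr_ge0// => b _; exact: sqr_ge0.
rewrite /singular_values xgetPN; last by move=> s sA; apply: nosv; exists s.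
rewrite nth_nil expr0n/= /mxtrace sumr_ge0// => i _.
by rewrite mxE sumr_ge0// => j _; rewrite !mxE -expr2 sqr_ge0.
Qed.

(** * The flat matrix with a lowered corner *)

Definition dented (R : realType) (m n : nat) (kappa c : R) : 'M[R]_(m.+1, n.+1) :=
  \matrix_(i, j) (kappa - c * ((i == ord0) && (j == ord0))%:R).

(** The columns are [kappa] times the all-ones vector and [- c] times the first
basis vector; together with [dentedR] this exhibits the rank two. *)
Definition dentedL (R : realType) (m : nat) (kappa c : R) : 'M[R]_(m.+1, 2) :=
  \matrix_(i, j) (if j == ord0 then kappa else - c * (i == ord0)%:R).

Definition dentedR (R : realType) (n : nat) : 'M[R]_(2, n.+1) :=
  \matrix_(i, j) (if i == ord0 then 1 else (j == ord0)%:R).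

Lemma dentedE (R : realType) (m n : nat) (kappa c : R) :
  dented m n kappa c = dentedL m kappa c *m dentedR R n.
Proof.
apply/matrixP => i j; rewrite !mxE !big_ord_recl big_ord0 !mxE/=.
by rewrite mulr1 addr0 -mulrA -natrM mulnb mulNr.
Qed.

(** With [A = L V] of inner dimension two, exchanging the factors of
[A^T A = V^T (L^T L V)] leaves the 2 x 2 matrix [(L^T L) (V V^T)], whose trace and
determinant are the prescribed sum and product; the latter equals the sum of
the squared 2 x 2 minors of [A], of which only those through the corner can
be nonzero. *)
Lemma char_poly_dented (R : realType) (m k : nat) (kappa c x y : R) :
  x + y = kappa ^+ 2 * (m.+1 * k.+2)%:R - 2 * kappa * c + c ^+ 2 ->
  x * y = m%:R * k.+1%:R * (kappa * c) ^+ 2 ->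
  char_poly ((dented m k.+1 kappa c)^T *m dented m k.+1 kappa c) =
  'X^k * (('X - x%:P) * ('X - y%:P)).
Proof.
move=> exD exM; set A := dented _ _ _ _.
(* all the Gram entries are sums whose terms agree outside the first index *)
have sumd (p : nat) (f : 'I_p.+1 -> R) (a b : R) :
    (forall i, f i = if i == ord0 then a else b) -> \sum_i f i = a + p%:R * b.
  move=> fE; rewrite big_ord_recl fE eqxx; congr (_ + _).
  rewrite (eq_bigr (fun=> b)) => [|i _]; last by rewrite fE.
  by rewrite sumr_const card_ord mulr_natl.
pose L := dentedL m kappa c; pose V := dentedR R k.+1.
have LL : L^T *m L = \matrix_(i, j)
    (if i == ord0 then if j == ord0 then m.+1%:R * kappa ^+ 2 else - (kappa * c)
     else if j == ord0 then - (kappa * c) else c ^+ 2).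
  apply/matrixP => i j; rewrite !mxE.
  case: (i == ord0) / boolP => i0; case: (j == ord0) / boolP => j0.
  - rewrite (@sumd _ _ (kappa ^+ 2) (kappa ^+ 2)) => [|l].
      by rewrite -natr1; ring.
    by rewrite !mxE i0 j0 -expr2 if_same.
  - rewrite (@sumd _ _ (- (kappa * c)) 0) => [|l]; first by ring.
    by rewrite !mxE i0 (negbTE j0); case: (l == ord0) => /=; ring.
  - rewrite (@sumd _ _ (- (kappa * c)) 0) => [|l]; first by ring.
    by rewrite !mxE j0 (negbTE i0); case: (l == ord0) => /=; ring.
  - rewrite (@sumd _ _ (c ^+ 2) 0) => [|l]; first by ring.
    by rewrite !mxE (negbTE i0) (negbTE j0); case: (l == ord0) => /=; ring.
have VV : V *m V^T = \matrix_(i, j)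
    (if (i == ord0) && (j == ord0) then k.+2%:R else 1).
  apply/matrixP => i j; rewrite !mxE.
  case: (i == ord0) / boolP => i0; case: (j == ord0) / boolP => j0 /=.
  - rewrite (@sumd _ _ 1 1) => [|l]; first by rewrite mulr1 nat1r.
    by rewrite !mxE i0 j0 mulr1 if_same.
  - rewrite (@sumd _ _ 1 0) => [|l]; first by ring.
    by rewrite !mxE i0 (negbTE j0); case: (l == ord0) => /=; ring.
  - rewrite (@sumd _ _ 1 0) => [|l]; first by ring.
    by rewrite !mxE j0 (negbTE i0); case: (l == ord0) => /=; ring.
  - rewrite (@sumd _ _ 1 0) => [|l]; first by ring.
    by rewrite !mxE (negbTE i0) (negbTE j0); case: (l == ord0) => /=; ring.
have tr2 (M : 'M[R]_2) : \tr M = M ord0 ord0 + M ord_max ord_max.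
  by rewrite /mxtrace big_ord_recr/= big_ord1; congr (M _ _ + _); apply/val_inj.
have det2 (M : 'M[R]_2) : \det M =
    M ord0 ord0 * M ord_max ord_max - M ord0 ord_max * M ord_max ord0.
  have l01 : lift ord0 ord0 = ord_max :> 'I_2 by apply/val_inj.
  have l10 : lift ord_max ord0 = ord0 :> 'I_2 by apply/val_inj.
  rewrite (expand_det_row _ ord0) big_ord_recr/= big_ord1 /cofactor !det_mx11 !mxE.
  have -> : widen_ord (leqnSn 1) ord0 = ord0 :> 'I_2 by apply/val_inj.
  by rewrite !l01 l10/=; ring.
have n10 : (ord_max == ord0 :> 'I_2) = false by [].
have cp2 : char_poly (L^T *m L *m (V *m V^T)) = ('X - x%:P) * ('X - y%:P).
  apply: char_poly2; rewrite ?exD ?exM.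
    rewrite tr2 LL VV !mxE big_ord_recr/= big_ord1.
    rewrite [in X in _ + X]big_ord_recr/= big_ord1 !mxE/=.
    by rewrite natrM; ring.
  rewrite det_mulmx !det2 LL VV !mxE/= -(natr1 k.+1) -(natr1 m); ring.
suff : 'X^2 * char_poly (A^T *m A) = 'X^2 * ('X^k * (('X - x%:P) * ('X - y%:P))).
  by apply: mulfI; rewrite expf_neq0// polyX_eq0.
rewrite /A dentedE trmx_mul -mulmxA char_poly_mulC -/L -/V.
have -> : L^T *m (L *m V) *m V^T = L^T *m L *m (V *m V^T) by rewrite !mulmxA.
by rewrite cp2 mulrA -exprD.
Qed.

(** The quadratic satisfied by the squared singular values takes at [c ^ 2] the
value [- c ^ 2 * kappa * (kappa * (m + k + 2) - 2 * c)], which is nonpositive.  So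
it has real roots and [c ^ 2] lies between them; the larger root is then bounded
below because the sum of the roots is the squared Frobenius norm.  At [c = 0]
this says that [sigma 2] vanishes. *)
Lemma sigma_dented (R : realType) (m k : nat) (kappa c : R) :
    0 <= c -> c <= kappa ->
  [/\ kappa ^+ 2 * (m.+1 * k.+2)%:R - 2 * kappa * c
        <= sigma 1 (dented m k.+1 kappa c) ^+ 2,
      0 <= sigma 1 (dented m k.+1 kappa c),
      0 <= sigma 2 (dented m k.+1 kappa c) &
      sigma 2 (dented m k.+1 kappa c) <= c].
Proof.
move=> c0 ck; have k0 : 0 <= kappa := le_trans c0 ck.
pose a := kappa ^+ 2 * (m.+1 * k.+2)%:R - 2 * kappa * c + c ^+ 2.
pose b := m%:R * k.+1%:R * (kappa * c) ^+ 2.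
pose D := a ^+ 2 - 4 * b.
have b0 : 0 <= b by rewrite !mulr_ge0.
have kc2 : 2 * kappa * c <= kappa ^+ 2 * (m.+1 * k.+2)%:R.
  apply: (@le_trans _ _ (kappa ^+ 2 * 2)).
    by rewrite -mulrA mulrC ler_wpM2r// expr2 ler_wpM2l.
  by rewrite ler_wpM2l ?sqr_ge0// ler_nat mulSn.
have a0 : 0 <= a by rewrite addr_ge0 ?sqr_ge0// subr_ge0.
(* left side minus right side is four times the quadratic at [c ^ 2] *)
have Dge : (2 * c ^+ 2 - a) ^+ 2 <= D.
  have -> : D = (2 * c ^+ 2 - a) ^+ 2
      + 4 * (c ^+ 2 * kappa * (kappa * (m%:R + k%:R + 2) - 2 * c)).
    by rewrite /D /a /b natrM -!natr1; ring.
  rewrite lerDl mulr_ge0// mulr_ge0 ?mulr_ge0 ?sqr_ge0// subr_ge0.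
  rewrite mulrC ler_pM// lerDr addr_ge0//.
have D0 : 0 <= D := le_trans (sqr_ge0 _) Dge.
pose r := Num.sqrt D.
have rr : r ^+ 2 = D by rewrite sqr_sqrtr.
have r0 : 0 <= r by exact: sqrtr_ge0.
have ra : r <= a by rewrite -ler_sqr ?nnegrE// rr /D gerBl mulr_ge0.
have rc : a - 2 * c ^+ 2 <= r.
  have : `|2 * c ^+ 2 - a| <= `|r|.
    by rewrite -ler_sqr ?nnegrE// !real_normK ?num_real// rr.
  by rewrite (ger0_norm r0) ler_norml => /andP[]; lra.
pose x := (a + r) / 2; pose y := (a - r) / 2.
have y0 : 0 <= y by rewrite /y; lra.
have yx : y <= x by rewrite /x /y; lra.
have x0 := le_trans y0 yx.
have [-> ->] : sigma 1 (dented m k.+1 kappa c) = Num.sqrt x /\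
               sigma 2 (dented m k.+1 kappa c) = Num.sqrt y.
  apply: sigma_char_poly; rewrite ?sqrtr_ge0 ?ler_wsqrtr// !sqr_sqrtr//.
  apply: char_poly_dented; rewrite -/a -/b; first by rewrite /x /y; field.
  have -> : x * y = (a ^+ 2 - r ^+ 2) / 4 by rewrite /x /y; field.
  by rewrite rr /D; field.
rewrite !sqrtr_ge0 sqr_sqrtr//; split => //.
  by rewrite -(lerD2r (c ^+ 2)) -/a /x; lra.
by rewrite -(ger0_norm c0) -sqrtr_sqr ler_wsqrtr// /y; lra.
Qed.

Lemma mx_norm_leP (R : realType) (m n : nat) (A : 'M[R]_(m, n)) (r : R) :
  0 <= r -> (forall i j, `|A i j| <= r) <-> mx_norm A <= r.
Proof.
move=> r0; rewrite mx_normrE; split => [Ar|/bigmax_leP[_ Ar] i j].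
  by apply/bigmax_leP; split=> // -[i j].
exact: (Ar (i, j)).
Qed.

(** * Membership in the matrix classes *)

Lemma Mclass_dented (R : realType) (m n : nat) (kappa c : R) :
  0 <= c -> c <= kappa -> Mclass kappa (dented m n kappa c).
Proof.
move=> c0 ck; split; last by rewrite dentedE mulmx_max_rank.
apply/mx_norm_leP => [|i j]; first exact: le_trans ck.
rewrite mxE; case: (_ && _) => /=; rewrite ?mulr1 ?mulr0 ler_norml; lra.
Qed.

Lemma sqr_sigma1_le (R : realType) (m n : nat) (kappa : R) (A : 'M[R]_(m, n)) :
  0 <= kappa -> mx_norm A <= kappa -> sigma 1 A ^+ 2 <= kappa ^+ 2 * (m * n)%:R.
Proof.
move=> k0 /(mx_norm_leP _ k0) Ak; apply: le_trans (sqr_sigma1_le_tr A) _.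
rewrite /mxtrace (@le_trans _ _ (\sum_(i < n) kappa ^+ 2 * m%:R))//; last first.
  by rewrite sumr_const card_ord -[leLHS]mulr_natr natrM mulrA.
apply: ler_sum => i _; rewrite mxE.
rewrite (@le_trans _ _ (\sum_(i < m) kappa ^+ 2))//; last first.
  by rewrite sumr_const card_ord -[leLHS]mulr_natr.
apply: ler_sum => j _; rewrite mxE -expr2 -[leLHS]real_normK ?num_real//.
by rewrite lerXn2r ?nnegrE.
Qed.

(** Among the matrices with entries bounded by [kappa], the flat one maximizes
[sigma 1], so a threshold that any of them reaches is reached by it. *)
Lemma Mclass1_flat (R : realType) (m k : nat) (kappa t : R) :
  0 <= kappa -> 0 <= t ->
  (Mclass1 kappa t : set 'M[R]_(m.+1, k.+2)) !=set0 ->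
  Mclass1 kappa t (dented m k.+1 kappa 0).
Proof.
move=> k0 t0 [A [[Ak _] tA _]].
have [s1 s1_ge0 s2_ge0 s2_le0] := @sigma_dented R m k kappa 0 (lexx 0) k0.
split; [exact: Mclass_dented| |by apply/eqP; rewrite eq_le s2_le0].
rewrite -ler_sqr ?nnegrE//; apply: le_trans s1.
rewrite mulr0 subr0; apply: le_trans (sqr_sigma1_le k0 Ak).
by rewrite ler_sqr ?nnegrE// (le_trans t0 tA).
Qed.

Lemma Mclass2_dented (R : realType) (m k : nat) (kappa c t1 t2 : R) :
    0 <= c -> c <= kappa -> c <= t2 -> 0 <= t1 ->
    t1 ^+ 2 + 2 * kappa * c <= kappa ^+ 2 * (m.+1 * k.+2)%:R ->
  Mclass2 kappa t1 t2 (dented m k.+1 kappa c).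
Proof.
move=> c0 ck ct2 t10 t1c.
have [s1 s1_ge0 s2_ge0 s2c] := @sigma_dented R m k kappa c c0 ck.
split; [exact: Mclass_dented| |exact: le_trans ct2].
by rewrite -ler_sqr ?nnegrE//; apply: le_trans s1; lra.
Qed.

(** Only the entry that is not observed depends on [c]. *)
Lemma drop11_dented (R : realType) (m n : nat) (kappa c : R)
    (U : 'M[R]_(m.+1, n.+1)) :
  drop11 (dented m n kappa c + U) = drop11 (dented m n kappa 0 + U).
Proof.
by apply/matrixP => i j; rewrite !mxE; case: (_ && _) => //=; rewrite !mulr0.
Qed.

(** * Covering two points with one interval *)

Lemma measurable_observed (R : realType) (d : measure_display)
    (Omega : measurableType d) (P : probability Omega R) (m n : nat)
    (u : 'I_m.+1 -> 'I_n.+1 -> {RV P >-> R}) (M : 'M[R]_(m.+1, n.+1))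
    (f : 'M[R]_(m.+1, n.+1) -> R) :
  mx_measurable f -> measurable_fun setT (f \o observed u M).
Proof.
move=> mf.
pose MT := g_sigma_algebraType (@mx_cylinders R m.+1 n.+1).
pose g : Omega -> MT := observed u M.
suff mg : measurable_fun setT g.
  exact: (measurableT_comp (mf : measurable_fun setT (f : MT -> R)) mg).
(* preimages of the cylinders suffice: each coordinate is constant or a
   translate of a random variable *)
refine (@measurability _ _ _ _ setT g (@mx_cylinders R m.+1 n.+1) erefl _).
move=> _ [_ [i [j [B [mB ->]]]] <-].
have : measurable_fun setT (fun w => observed u M w i j).
  have -> : (fun w => observed u M w i j) =
      if (i == ord0) && (j == ord0) then cst 0 else fun w => M i j + u i j w.
    by apply/funext => w; rewrite !mxE; case: ifP.
  case: ifP => _; first exact: measurable_cst.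
  by apply: measurable_funD => //; exact: measurable_cst.
by move=> /(_ measurableT B mB).
Qed.

(** The pointwise bound: a single point counts for at most 1, and if both are
covered then the length is at least [c], so that [1 + length / c >= 2].
Integrating it plays the role of inclusion-exclusion and Markov's inequality
together. *)
Lemma coverage_two_points (R : realType) (d : measure_display)
    (T : measurableType d) (P : probability T R) (L U : T -> R) (a b c : R) :
    measurable_fun setT L -> measurable_fun setT U ->
    (forall w, L w <= U w) -> 0 < c -> c <= `|a - b| ->
  (P [set w | (L w <= a <= U w)%R] + P [set w | (L w <= b <= U w)%R]
     <= 1 + c^-1%:E * 'E_P[fun w => (U w - L w)%R])%E.
Proof.
move=> mL mU LU c0 cab.
have mI x : measurable [set w | L w <= x <= U w].
  have -> : [set w | L w <= x <= U w] =
      (setT `&` L @^-1` `]-oo, x]) `&` (setT `&` U @^-1` `[x, +oo[).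
    apply/seteqP; split=> w /=; rewrite !in_itv/= ?andbT.
      by move=> /andP[].
    by move=> [[_ ->] [_ ->]].
  by apply: measurableI; [exact: mL|exact: mU].
have mUL : measurable_fun setT (fun w => U w - L w) by exact: measurable_funB.
have UL0 w : 0 <= U w - L w by rewrite subr_ge0.
have int_ind x : P [set w | (L w <= x <= U w)%R]
    = (\int[P]_w (\1_[set w | (L w <= x <= U w)%R] w)%:E)%E.
  by rewrite integral_indic// setIT.
have int_one : (\int[P]_w (1 : R)%:E)%E = 1%E.
  rewrite integral_cst//. rewrite mul1e; exact: probability_setT.
have m1 x : measurable_fun setT
    (fun w => (\1_[set v | L v <= x <= U v] w : R)%:E).
  by apply/measurable_EFinP; exact: measurable_indic.
have mlen : measurable_fun setT (fun w => (c^-1)%:E * (U w - L w)%:E)%E.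
  by apply: emeasurable_funM => //; exact/measurable_EFinP.
have len0 w : setT w -> (0 <= (c^-1)%:E * (U w - L w)%:E)%E.
  by move=> _; rewrite mule_ge0 ?lee_fin ?invr_ge0// ltW.
rewrite !int_ind unlock -ge0_integralZl//; last 3 first.
- exact/measurable_EFinP.
- by move=> w _; rewrite lee_fin.
- by rewrite lee_fin invr_ge0 ltW.
rewrite -int_one -!ge0_integralD//.
apply: ge0_le_integral => //.
- by move=> w _; rewrite adde_ge0.
- exact: emeasurable_funD.
- exact: emeasurable_funD.
move=> w _.
have memI x : (w \in [set v | L v <= x <= U v]) = (L w <= x <= U w).
  by apply/idP/idP; rewrite inE.
rewrite -EFinM -!EFinD lee_fin !indicE !memI.
have Lw := LU w.
case: (boolP (L w <= a <= U w)) => [/andP[La aU]|_]; last first.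
  have : 0 <= c^-1 * (U w - L w) by rewrite mulr_ge0 ?invr_ge0// ltW.
  by case: (_ && _) => /=; lra.
case: (boolP (L w <= b <= U w)) => [/andP[Lb bU]|_] /=; last first.
  have : 0 <= c^-1 * (U w - L w) by rewrite mulr_ge0 ?invr_ge0// ltW.
  lra.
rewrite lerD2l mulrC ler_pdivlMr// mul1r; apply: le_trans cab _.
by rewrite ler_norml; lra.
Qed.

(** * The limit *)

Lemma limf_esup_le (T : choiceType) (X : filteredType T) (R : realType)
    (f : X -> \bar R) (F : set_system X) (l : R) :
  (forall e : R, 0 < e -> F [set x | (f x <= (l + e)%:E)%E]) ->
  (limf_esup f F <= l%:E)%E.
Proof.
move=> fl; apply/lee_addgt0Pr => e e0.
apply: le_trans (_ : (ereal_sup (f @` [set x | (f x <= (l + e)%:E)%E]) <= _)%E).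
  apply: ereal_inf_lbound.
  by exists [set x | (f x <= (l + e)%:E)%E] => //; exact: fl.
by apply: ge_ereal_sup => _ [x /= + <-].
Qed.

(* The matrices are n.+1 x T.+1, so that the (1,1) entry exists; the tuning
   sequences are evaluated at these dimensions.  "n, T -> oo" is the product
   filter, i.e. min(n, T) -> oo. *)
Theorem theorem4 (R : realType) (kappa : R) (tau0 tau1 tau2 : nat -> nat -> R)
    (d : nat -> nat -> measure_display)
    (Omega : forall n T, measurableType (d n T))
    (P : forall n T, probability (Omega n T) R)
    (u : forall n T, 'I_n.+1 -> 'I_T.+1 -> {RV (P n T) >-> R})
    (I : forall n T, interval_procedure R n.+1 T.+1)
    (kappa_gt0 : 0 < kappa)
    (u_iid : forall n T, iid_std_normal (u n T))
    (tau2_gt0 : forall n T, 0 < tau2 n.+1 T.+1)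
    (tau21 : forall n T, tau2 n.+1 T.+1 <= tau1 n.+1 T.+1)
    (tau10 : forall n T, tau1 n.+1 T.+1 <= tau0 n.+1 T.+1)
    (* the classes are nonempty, so that the sup and the inf make sense *)
    (M1_nonempty : \forall n \near \oo & T \near \oo,
       (Mclass1 kappa (tau0 n.+1 T.+1) : set 'M[R]_(n.+1, T.+1)) !=set0)
    (* tau1 stays off the largest value kappa * sqrt (n T) that sigma_1 can
       take on the class *)
    (tau1_attainable : exists2 delta : R, 0 < delta &
       \forall n \near \oo & T \near \oo,
         tau1 n.+1 T.+1 ^+ 2 + delta <= kappa ^+ 2 * (n.+1 * T.+1)%:R)
    (tau0_gtrsim1 : gtrsim1 tau0)
    (short : (fun p : nat * nat =>
        ereal_sup [set expected_length (u p.1 p.2) (I p.1 p.2) M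
                  | M in Mclass1 kappa (tau0 p.1.+1 p.2.+1)])
      @ filter_prod \oo \oo --> (0 : \bar R))
    (tau2_gtrsim1 : gtrsim1 tau2) :
  (limf_esup (fun p : nat * nat =>
      ereal_inf [set coverage (u p.1 p.2) (I p.1 p.2) M
                | M in Mclass2 kappa
                            (tau1 p.1.+1 p.2.+1) (tau2 p.1.+1 p.2.+1)])
     (filter_prod \oo \oo) <= (2^-1 : R)%:E)%E.
Proof.
have [delta delta0 tau1_lt] := tau1_attainable.
have [c2 c20 c2_tau2] := tau2_gtrsim1.
(* the three bounds put M' in the entrywise ball, below tau_2, and above tau_1 *)
pose c := Num.min (Num.min kappa c2) (delta / (2 * kappa)).
have c0 : 0 < c by rewrite !lt_min kappa_gt0 c20 divr_gt0// mulr_gt0.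
have ck : c <= kappa by rewrite !ge_min lexx.
have cc2 : c <= c2 by rewrite !ge_min lexx orbT.
have cdelta : 2 * kappa * c <= delta.
  by rewrite mulrC -ler_pdivlMr ?mulr_gt0// ge_min lexx orbT.
apply: limf_esup_le => e e0.
have T_gt0 : \forall n \near \oo & T \near \oo, (0 < T)%N.
  exists (setT, [set T | (0 < T)%N]); last by move=> [n T] [].
  by split; [exact: filterT | exact: nbhs_infty_gt].
have short_e : \forall n \near \oo & T \near \oo,
    (ereal_sup [set expected_length (u n T) (I n T) M
               | M in Mclass1 kappa (tau0 n.+1 T.+1)] < (c * (2 * e))%:E)%E.
  apply: (short [set x | (x < (c * (2 * e))%:E)%E]).
  apply: open_nbhs_nbhs; split; first exact: open_ereal_lt_ereal.
  by rewrite /= lte_fin !mulr_gt0.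
have prodF : Filter (filter_prod \oo \oo : set_system (nat * nat)).
  exact: filter_prod_filter.
have ev := @filterI _ _ prodF _ _ (@filterI _ _ prodF _ _ M1_nonempty tau1_lt)
  (@filterI _ _ prodF _ _ T_gt0 short_e).
(* at least two columns, so that a second singular value is listed *)
refine (@filterS _ _ prodF _ _ _ ev) => -[n [|k]] [[/= M1 tau1_le]] [//= _ len_lt].
have tau2_ge0 := ltW (tau2_gt0 n k.+1).
have tau1_ge0 := le_trans tau2_ge0 (tau21 n k.+1).
have tau0_ge0 := le_trans tau1_ge0 (tau10 n k.+1).
pose M := dented n k.+1 kappa 0; pose M' := dented n k.+1 kappa c.
have M1M : Mclass1 kappa (tau0 n.+1 k.+2) M.
  by apply: Mclass1_flat => //; exact: ltW.
have M2M : Mclass2 kappa (tau1 n.+1 k.+2) (tau2 n.+1 k.+2) M.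
  case: M1M => MM tau0M sigma2M; split; rewrite ?sigma2M//.
  exact: le_trans (tau10 _ _) tau0M.
have M2M' : Mclass2 kappa (tau1 n.+1 k.+2) (tau2 n.+1 k.+2) M'.
  apply: Mclass2_dented => //; first exact: ltW.
    exact: le_trans cc2 (c2_tau2 _ _).
  by apply: le_trans tau1_le; rewrite lerD2l.
set v := ereal_inf _.
have vM : (v <= coverage (u n k.+1) (I n k.+1) M)%E.
  by apply: ereal_inf_lbound; exists M.
have vM' : (v <= coverage (u n k.+1) (I n k.+1) M')%E.
  by apply: ereal_inf_lbound; exists M'.
have lenM : (expected_length (u n k.+1) (I n k.+1) M <= (c * (2 * e))%:E)%E.
  by apply: le_trans (ltW len_lt); apply: ereal_sup_ubound; exists M.
have cov : (coverage (u n k.+1) (I n k.+1) M + coverage (u n k.+1) (I n k.+1) M'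
    <= 1 + c^-1%:E * expected_length (u n k.+1) (I n k.+1) M)%E.
  have obsM' : observed (u n k.+1) M' = observed (u n k.+1) M.
    by apply/funext => w; exact: drop11_dented.
  rewrite /coverage obsM'; apply: coverage_two_points => //.
  - exact: measurable_observed (lower_measurable _).
  - exact: measurable_observed (upper_measurable _).
  - by move=> w; exact: lower_le_upper.
  - by rewrite !mxE/= !mulr1 subr0 opprB addrC subrK ger0_norm// ltW.
have vv : (v + v <= (1 + 2 * e)%:E)%E.
  apply: le_trans (leeD vM vM') _; apply: le_trans cov _.
  have -> : 1 + 2 * e = 1 + c^-1 * (c * (2 * e)) by rewrite mulKf// gt_eqF.
  rewrite EFinD EFinM leeD2l//; apply: lee_wpmul2l lenM.
  by rewrite lee_fin invr_ge0 ltW.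
case: v vv {vM vM'} => [v|//|_]; last exact: leNye.
by rewrite -EFinD !lee_fin; lra.
Qed.
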